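(* Let $b\ge2$ and $n,d\ge1$ be integers with $\gcd(b,d)=1$, and let $S_{b,d}$ be the finite set of integers $s\ge1$ that cannot be represented as $s=bk+d\ell$ with integers $k,\ell\ge0$. If $\omega$ is a primitive $d$th root of unity with $d\mid(n+1)$, then for every integer $k\ge0$ we have $$\omega^k\genfrac{[}{]}{0pt}{}{n}{k}_\omega^{(b)}=\binom{(n+1)/d-1}{k/d}^{(b)}+\sum_{s\in S_{b,d}}\binom{(n+1)/d-1}{(k-1-s)/d}^{(b)}-\sum_{s\in S_{b,d}}\binom{(n+1)/d-1}{(k-s)/d}^{(b)},$$ where $\binom{u}{v}^{(b)}:=0$ when $u$ or $v$ is not an integer.
   Context: The integers $\binom{n}{k}^{(b)}$ are defined by $\sum_k\binom{n}{k}^{(b)}t^k=(1+t+\cdots+t^{b-1})^n$ (so they vanish for integers $k$ outside $0\le k\le(b-1)n$), and the polynomials $\genfrac{[}{]}{0pt}{}{n}{k}_q^{(b)}\in\mathbb{N}[q]$ by $\sum_k\genfrac{[}{]}{0pt}{}{n}{k}_q^{(b)}t^k=\prod_{i=0}^{n-1}(1+q^it+\cdots+(q^it)^{b-1})$; $\genfrac{[}{]}{0pt}{}{n}{k}_\omega^{(b)}$ is the evaluation at $q=\omega$. *)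

(* Defs.v *)
From mathcomp Require Export all_boot all_order all_algebra.
From mathcomp Require Export boolp classical_sets cardinality fsbigop.

Set Implicit Arguments.
Unset Strict Implicit.
Unset Printing Implicit Defensive.

Export GRing.Theory Num.Theory.

Local Open Scope classical_set_scope.
Local Open Scope ring_scope.

(* The coefficient of t^k in (1 + t + ... + t^(b-1))^n, for an integer k. *)
Definition polynomial_binom (b n : nat) (k : int) : nat :=
  if k is Posz m then (((\sum_(j < b) 'X^j) ^+ n : {poly nat})`_m)%R else 0%N.

(* The extension by 0 to non-integral u or v. The polynomial expansion only
   makes sense for u >= 0, hence the test in Num.nat: the value 0 for negative
   integers u is a convention. *)
Definition polynomial_binomQ (b : nat) (u v : rat) : nat :=
  if (u \is a Num.nat) && (v \is a Num.int)
  then polynomial_binom b (Num.truncn u) (Num.floor v) else 0%N.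

(* N[q] is {poly nat}, so that in {poly {poly nat}} the outer variable is t,
   and q is the scalar 'X : {poly nat}. *)
Definition qpolynomial_binom (b n k : nat) : {poly nat} :=
  (\prod_(i < n) \sum_(j < b)
     (('X^i : {poly nat}) *: 'X) ^+ j : {poly {poly nat}})`_k.

Definition eval_nat_poly (R : nzRingType) (p : {poly nat}) (x : R) : R :=
  (map_poly (GRing.natmul 1) p).[x].

Definition nonrepresentable (b d : nat) : set nat :=
  [set s | (1 <= s)%N /\ ~ exists k l : nat, s = (b * k + d * l)%N].

(* This makes the sums \sum_(s \in nonrepresentable b d) F s genuine for every
   F: these are 0 by convention when F has infinite support in the set. *)
Lemma finite_nonrepresentable (b d : nat) :
  (0 < d)%N -> coprime b d -> finite_set (nonrepresentable b d).
Proof.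
move=> d_gt0 co_bd; apply: (@sub_finite_set _ _ `I_(b * d)%N); last first.
  exact: finite_II.
move=> s /= [_ nrep]; rewrite ltnNge; apply/negP => le_bd_s; apply: nrep.
pose x := chinese b d 0 s.
have /dvdnP[y xE] : (b %| x)%N.
  by rewrite /dvdn /x chinese_modl // mod0n.
have bk_mod : (b * (y %% d) = s %[mod d])%N.
  by rewrite modnMmr mulnC -xE /x chinese_modr.
have le_bk : (b * (y %% d) <= s)%N.
  by apply: leq_trans le_bd_s; rewrite leq_mul2l ltnW ?orbT // ltn_mod.
have /dvdnP[l lE] : (d %| s - b * (y %% d))%N.
  by rewrite -eqn_mod_dvd // bk_mod.
by exists (y %% d)%N, l; rewrite [(d * l)%N]mulnC -lE subnKC.
Qed.

(* Main.v *)
Require Import Defs.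
From mathcomp Require Import zify ring.

(**
  Put B(t) = 1 + t + ... + t^(b-1), n + 1 = d m, G(t) = sum of t^s over S_{b,d},
  and let P(t) be the product of the B(w^i t), 0 <= i < n.  As w^b is again a
  primitive d-th root of unity, the product of B(w^i t) over a full period
  0 <= i < d is (1 - t^(bd)) / (1 - t^d) = B(t^d); hence P(w t) B(t), which runs
  over m full periods, is B(t^d)^m.  On the other hand each representable s is
  uniquely b k + d l with l < b, so (1 - t^b) G(t) = B(t) - B(t^d), that is
  B(t^d) = B(t) (1 + (t - 1) G(t)).  Cancelling B(t) gives
  P(w t) = B(t^d)^(m-1) (1 + (t - 1) G(t)), whose coefficients are the claim.
*)

Local Open Scope classical_set_scope.
Local Open Scope ring_scope.

(** Used to absorb the factor [w ^+ k] of the theorem into the substitution t -> w t. *)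
Lemma coef_comp_polyZX {R : comNzRingType} (p : {poly R}) (w : R) (k : nat) :
  (p \Po (w *: 'X))`_k = w ^+ k * p`_k.
Proof.
rewrite coef_comp_poly (eq_bigr (fun i : 'I__ => p`_i * w ^+ i *+ (k == i))).
  have [ltkp|lepk] := ltnP k (size p).
    rewrite (bigD1 (Ordinal ltkp)) //= eqxx mulrC big1 ?addr0 // => i.
    by rewrite -val_eqE eq_sym => /negPf/= ->.
  rewrite nth_default // mulr0 big1 // => i _.
  by rewrite gtn_eqF // (leq_trans (ltn_ord i)).
by move=> i _; rewrite exprZn coefZ coefXn mulrA mulr_natr.
Qed.

(** Stated over a semiring to cover both [nat], where the coefficients are defined, and a field,
    where factors can be cancelled. *)
Definition geom_poly (R : nzSemiRingType) (b : nat) : {poly R} :=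
  \sum_(j < b) 'X^j.

Lemma coef_geom_poly (R : nzSemiRingType) (b i : nat) :
  (geom_poly R b)`_i = (i < b)%:R.
Proof.
rewrite coef_sum; under eq_bigr do rewrite coefXn.
have [ltib|leib] := ltnP i b.
  rewrite (bigD1 (Ordinal ltib)) //= eqxx big1 ?addr0 // => j.
  by rewrite -val_eqE eq_sym => /negPf/= ->.
by rewrite big1 // => j _; rewrite gtn_eqF // (leq_trans (ltn_ord j)).
Qed.

Lemma geom_poly_neq0 (R : nzSemiRingType) (b : nat) :
  (0 < b)%N -> geom_poly R b != 0.
Proof.
move=> b_gt0; apply/negP => /eqP/(congr1 (fun p : {poly R} => p`_0)).
by rewrite coef_geom_poly b_gt0 coef0; apply/eqP/oner_neq0.
Qed.

Lemma mul_geom_poly (R : comNzRingType) (b : nat) :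
  (1 - 'X) * geom_poly R b = 1 - 'X^b.
Proof.
rewrite -[1 - 'X^b]opprB subrX1 -mulNr opprB; congr (_ * _).
Qed.

Lemma mul_geom_poly_comp (R : comNzRingType) (b : nat) (q : {poly R}) :
  (1 - q) * (geom_poly R b \Po q) = 1 - q ^+ b.
Proof.
have := congr1 (comp_poly q) (mul_geom_poly R b).
by rewrite /= comp_polyM !comp_polyB comp_polyX comp_Xn_poly -polyC1 comp_polyC.
Qed.

Lemma map_geom_poly {R S : nzSemiRingType} (f : {rmorphism R -> S}) (b : nat) :
  map_poly f (geom_poly R b) = geom_poly S b.
Proof. by rewrite rmorph_sum; apply: eq_bigr => j _; rewrite /= map_polyXn. Qed.

(** With v = w^(d-1), the inverse of w, one has X - v^i = -v^i (1 - w^i X). So the factorization of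
    X^d - 1 over the powers of v gives the product up to a constant [c], and evaluation at 0 yields
    c = -1. *)
Lemma prod_1subXprim {F : fieldType} {d : nat} {w : F} :
  d.-primitive_root w -> \prod_(i < d) (1 - w ^+ i *: 'X) = 1 - 'X^d.
Proof.
move=> prim_w; have d_gt0 := prim_order_gt0 prim_w.
have vwE (i : nat) : (w ^+ d.-1) ^+ i * w ^+ i = 1.
  by rewrite -exprMn -exprSr prednK // (prim_expr_order prim_w) expr1n.
have prim_v : d.-primitive_root (w ^+ d.-1).
  by rewrite prim_root_exp_coprime // coprime_sym coprimenP.
pose c : F := \prod_(i < d) - (w ^+ d.-1) ^+ i.
have facE : 'X^d - 1 = c%:P * \prod_(i < d) (1 - w ^+ i *: 'X).
  rewrite -(factor_Xn_sub_1 prim_v) big_mkord rmorph_prod -big_split /=.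
  apply: eq_bigr => i _; rewrite mul_polyC scalerBr scalerA mulNr vwE scaleN1r.
  by rewrite opprK scaleNr addrC alg_polyC.
have cE : c = -1.
  have := congr1 (fun p : {poly F} => p.[0]) facE.
  rewrite /= !hornerE expr0n gtn_eqF // sub0r horner_prod big1 ?mulr1 //.
  by move=> i _; rewrite hornerD hornerN hornerZ hornerX mulr0 subr0 hornerC.
by rewrite -[RHS]opprB facE cE polyCN polyC1 mulN1r opprK.
Qed.

Lemma prod_geom_prim {F : fieldType} {b d : nat} {w : F} :
    coprime b d -> d.-primitive_root w ->
  \prod_(i < d) (geom_poly F b \Po (w ^+ i *: 'X)) = geom_poly F b \Po 'X^d.
Proof.
move=> co_bd prim_w; have d_gt0 := prim_order_gt0 prim_w.
have nz : 1 - 'X^d != 0 :> {poly F}.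
  by rewrite -oppr_eq0 opprB -size_poly_gt0 size_XnsubC.
apply: (mulfI nz); rewrite mul_geom_poly_comp -{1}(prod_1subXprim prim_w).
rewrite -big_split /=.
(* Each factor telescopes to 1 - w^(bi) X^b. Seen as a polynomial in X^b, it is a factor of
   [prod_1subXprim] for the primitive root w^b. *)
rewrite (eq_bigr (fun i : 'I_d => (1 - (w ^+ b) ^+ i *: 'X) \Po 'X^b));
  last first.
  move=> i _; rewrite mul_geom_poly_comp exprZn -!exprM [(i * b)%N]mulnC.
  by rewrite comp_polyB comp_polyZ comp_polyX -polyC1 comp_polyC.
rewrite -[LHS](rmorph_prod (comp_poly 'X^b)) prod_1subXprim; last first.
  by rewrite prim_root_exp_coprime.
by rewrite /= comp_polyB comp_Xn_poly -polyC1 comp_polyC -!exprM mulnC.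
Qed.

Definition representable (b d s : nat) : bool :=
  `[< exists k l : nat, s = (b * k + d * l)%N >].

Lemma nonrepresentableE (b d s : nat) :
  nonrepresentable b d s <-> ~~ representable b d s.
Proof.
split=> [[_ nrep]|/asboolP nrep]; first exact/asboolP.
split=> //; rewrite lt0n; apply/negP => /eqP s0.
by apply: nrep; exists 0%N, 0%N; rewrite s0 !muln0.
Qed.

Lemma representable_lt (b d s : nat) :
  (s < b)%N -> representable b d s = (d %| s)%N.
Proof.
move=> ltsb; apply/asboolP/dvdnP => [[[|k] [l sE]]|[l ->]].
- by exists l; rewrite sE muln0 mulnC.
- by move: ltsb; rewrite sE mulnS -addnA ltnNge leq_addr.
- by exists 0%N, l; rewrite muln0 mulnC.
Qed.

(** A representation of s with k > 0 gives one of s - b. With k = 0, s = d l, and if l >= b then b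
    copies of d can be traded for d copies of b. What remains is s = d l with l < b, and then s - b
    is not representable. *)
Lemma representable_sub {b d s : nat} :
    (0 < d)%N -> coprime b d -> (b <= s)%N ->
  (representable b d s : nat) =
  (representable b d (s - b) + ((d %| s)%N && (s %/ d < b)%N))%N.
Proof.
move=> d_gt0 co_bd lebs.
have [/andP[/dvdnP[l sE]]|ndv] := boolP ((d %| s)%N && (s %/ d < b)%N).
  rewrite sE mulnK // => ltlb.
  have -> : representable b d (l * d).
    by apply/asboolP; exists 0%N, l; rewrite muln0 mulnC.
  suff /negPf -> : ~~ representable b d (l * d - b) by [].
  (* Otherwise b divides (l - l') d, hence l - l', although 0 < l - l' <= l < b. *)
  apply/asboolP => -[k [l' E]].
  have sE' : (l * d = b * k.+1 + d * l')%N.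
    by rewrite mulnS -addnA -E subnKC // -sE.
  have lel : (l' < l)%N.
    by rewrite -(ltn_pmul2r d_gt0) sE' [(d * l')%N]mulnC -addn1 addnC leq_add2r
      muln_gt0 (leq_ltn_trans _ ltlb).
  have : (b %| (l - l') * d)%N.
    by rewrite mulnBl sE' [(d * l')%N]mulnC addnK dvdn_mulr.
  rewrite Gauss_dvdl // => /(dvdn_leq _)-/(_ _)/=; rewrite subn_gt0 lel.
  by move=> /(_ isT); rewrite leqNgt (leq_ltn_trans (leq_subr _ _) ltlb).
rewrite addn0; congr nat_of_bool; apply/asboolP/asboolP; last first.
  by move=> [k [l E]]; exists k.+1, l; rewrite mulnS -addnA -E subnKC.
case=> [[|k] [l E]]; last first.
  by exists k, l; rewrite E mulnS -addnA addKn.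
move: ndv; rewrite E muln0 add0n dvdn_mulr // mulKn // -leqNgt => lebl.
(* The trade: d l - b = b (d - 1) + d (l - b). *)
exists d.-1, (l - b)%N; rewrite mulnBr [(d * b)%N]mulnC -[in RHS](subnKC lebl).
by nia.
Qed.

(** Compared coefficientwise: below b only the multiples of d are representable, and from b on this
    is [representable_sub]. *)
Lemma gap_identity (R : comNzRingType) {b d : nat} {S : seq nat} :
    (0 < d)%N -> coprime b d -> uniq S ->
    (forall s, (s \in S) = ~~ representable b d s) ->
  (1 - 'X^b) * \sum_(s <- S) 'X^s = geom_poly R b - (geom_poly R b \Po 'X^d).
Proof.
move=> d_gt0 co_bd uS SE.
have coefS i : (\sum_(s <- S) 'X^s : {poly R})`_i = (~~ representable b d i)%:R.
  rewrite coef_sum -SE; under eq_bigr do rewrite coefXn.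
  rewrite -natr_sum -big_mkcond /= sum1_count -(count_uniq_mem _ uS).
  by congr (_%:R); apply: eq_count => s; rewrite /= eq_sym.
apply/polyP => i; rewrite mulrBl mul1r !coefB coefXnM coef_comp_poly_Xn //.
rewrite !coef_geom_poly !coefS; case: ltnP => [ltib|leib].
  rewrite representable_lt // subr0; case: ifP => _ /=; last by rewrite subr0.
  by rewrite (leq_ltn_trans (leq_div _ _) ltib) subrr.
have := representable_sub d_gt0 co_bd leib.
case: (d %| i)%N => /=; case: (i %/ d < b)%N; case: (representable b d i);
  by case: (representable b d (i - b)) => //= _; rewrite ?subrr.
Qed.

Lemma coef_geom_polyX_comp (b u d k : nat) (R : comNzRingType) : (0 < d)%N ->
  ((geom_poly R b) ^+ u \Po 'X^d)`_k =
  (if (d %| k)%N then polynomial_binom b u (k %/ d)%N else 0%N)%:R.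
Proof.
move=> d_gt0; rewrite coef_comp_poly_Xn //; case: ifP => //= _.
rewrite -(map_geom_poly (GRing.natmul 1 : {rmorphism nat -> R})) -rmorphXn /=.
by rewrite coef_map.
Qed.

(** Substituting X^d encodes the convention for non-integral lower arguments: exponents not
    divisible by d get coefficient 0. *)
Lemma polynomial_binomQ_int (b u d : nat) (z : int) (R : comNzRingType) :
    (0 < d)%N ->
  (polynomial_binomQ b u%:R (z%:~R / d%:R))%:R =
  (if z is Posz k then ((geom_poly R b) ^+ u \Po 'X^d)`_k else 0) :> R.
Proof.
move=> d_gt0; rewrite /polynomial_binomQ natr_nat natrK /=.
have d0 : d%:R != 0 :> rat by rewrite pnatr_eq0 -lt0n.
have zE (v : int) : z%:~R / d%:R = v%:~R :> rat -> z = v * d.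
  by move=> E; apply: (@intr_inj rat); rewrite intrM -E divfK.
case: ifPn => [/intrP[v vE]|nint].
  rewrite vE intrKfloor (zE _ vE) /=.
  case: v {vE} => [v|v].
    by rewrite -PoszM coef_geom_polyX_comp // dvdn_mull // mulnK.
  (* The product is nonzero, so its opposite is a [Negz] and falls in the zero branch. *)
  rewrite NegzE mulNr -PoszM.
  by case: (v.+1 * d)%N (muln_gt0 v.+1 d) => //; rewrite d_gt0.
case: z nint {zE} => // k nint; rewrite coef_geom_polyX_comp //.
case: dvdnP nint => // -[q ->]; rewrite PoszM intrM mulfK //.
by rewrite intr_int.
Qed.

(** Evaluation at q = w is a ring morphism [ev], so it passes through the coefficient in t to each
    factor of the product. *)
Lemma eval_qpolynomial_binom {R : comNzRingType} (b n k : nat) (w : R) :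
  eval_nat_poly (qpolynomial_binom b n k) w =
  (\prod_(i < n) (geom_poly R b \Po (w ^+ i *: 'X)))`_k.
Proof.
pose ev : {rmorphism {poly nat} -> R} :=
  horner_eval w \o map_poly (GRing.natmul 1 : {rmorphism nat -> R}).
rewrite /qpolynomial_binom -[LHS]/(ev _) -coef_map rmorph_prod.
congr ((polyseq _)`_k); apply: eq_bigr => i _; rewrite rmorph_sum [RHS]rmorph_sum.
apply: eq_bigr => j _; rewrite /= comp_Xn_poly rmorphXn /= map_polyZ map_polyX.
by rewrite /= /horner_eval map_polyXn hornerXn.
Qed.

Lemma prod_periodic {R : comNzRingType} (m d : nat) (f : nat -> R) :
    (forall i, f (d + i)%N = f i) ->
  \prod_(i < m * d) f i = (\prod_(i < d) f i) ^+ m.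
Proof.
move=> fP; elim: m => [|m IHm]; first by rewrite big_ord0.
rewrite -[RHS]/(_ ^+ m.+1) exprS -IHm mulSn big_split_ord /=; congr (_ * _).
by apply: eq_bigr => i _; rewrite fP.
Qed.

Lemma prod_geom_rotate {F : fieldType} {b d m n : nat} {w : F} {S : seq nat} :
    (0 < b)%N -> coprime b d -> d.-primitive_root w -> n.+1 = (m.+1 * d)%N ->
    uniq S -> (forall s, (s \in S) = ~~ representable b d s) ->
  (\prod_(i < n) (geom_poly F b \Po (w ^+ i *: 'X))) \Po (w *: 'X) =
  ((geom_poly F b) ^+ m \Po 'X^d) * (1 + ('X - 1) * \sum_(s <- S) 'X^s).
Proof.
move=> b_gt0 co_bd prim_w nE uS SE; have d_gt0 := prim_order_gt0 prim_w.
have nz : geom_poly F b != 0 :> {poly F} by apply: geom_poly_neq0.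
apply: (mulIf nz).
transitivity ((geom_poly F b \Po 'X^d) ^+ m.+1); last first.
  rewrite -mulrA [_ ^+ m \Po _]rmorphXn exprSr /=; congr (_ * _).
  have := gap_identity F d_gt0 co_bd uS SE; rewrite -mul_geom_poly => E.
  have -> : geom_poly F b \Po 'X^d =
      geom_poly F b - (1 - 'X) * geom_poly F b * \sum_(s <- S) 'X^s.
    by rewrite E subKr.
  by ring.
rewrite -(prod_geom_prim co_bd prim_w).
rewrite -(@prod_periodic _ m.+1 d (fun i => geom_poly F b \Po (w ^+ i *: 'X)));
  last first.
  by move=> i; rewrite exprD (prim_expr_order prim_w) mul1r.
(* The rotation shifts the index i to i + 1; the extra factor [geom_poly F b] supplies the index
   0. *)
rewrite -nE big_ord_recl scale1r comp_polyXr mulrC; congr (_ * _).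
rewrite rmorph_prod; apply: eq_bigr => i _ /=.
by rewrite -comp_polyA comp_polyZ comp_polyX scalerA -exprSr.
Qed.

Theorem theorem4p3 (C : numClosedFieldType) (b n d : nat) (w : C)
    (hb : (2 <= b)%N) (hn : (1 <= n)%N) (hd : (1 <= d)%N)
    (hbd : gcdn b d = 1%N) (hw : d.-primitive_root w) (hdn : (d %| n.+1)%N)
    (k : nat) :
  w ^+ k * eval_nat_poly (qpolynomial_binom b n k) w =
    (polynomial_binomQ b ((n%:R + 1) / d%:R - 1) (k%:R / d%:R))%:R
    + \sum_(s \in nonrepresentable b d)
        ((polynomial_binomQ b ((n%:R + 1) / d%:R - 1)
                              ((k%:R - 1 - s%:R) / d%:R))%:R : C)
    - \sum_(s \in nonrepresentable b d)
        ((polynomial_binomQ b ((n%:R + 1) / d%:R - 1)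
                              ((k%:R - s%:R) / d%:R))%:R : C).
Proof.
have co_bd : coprime b d by apply/eqP.
have [[|m] nE] := dvdnP hdn; first by [].
have -> : (n%:R + 1) / d%:R - 1 = m%:R :> rat.
  rewrite natr1.
  by rewrite nE natrM mulfK ?pnatr_eq0 -?lt0n // -natr1 addrK.
have finS := finite_nonrepresentable hd co_bd.
rewrite !fsbig_finite //=; set S : seq nat := finmap.enum_fset _.
have SE s : (s \in S) = ~~ representable b d s.
  apply/idP/idP => [|nrep].
    by rewrite in_fset_set // => /set_mem/nonrepresentableE.
  by rewrite in_fset_set //; apply/mem_set/nonrepresentableE.
have uS : uniq S by apply: finmap.fset_uniq.
set P : {poly C} := geom_poly C b ^+ m \Po 'X^d.
have PE (z : int) : (polynomial_binomQ b m%:R (z%:~R / d%:R))%:R =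
    (if z is Posz i then P`_i else 0) :> C by apply: polynomial_binomQ_int.
(* For i < s both sides are 0: the difference is negative, and X^s divides the product. *)
have PsubE (i s : nat) :
    (if Posz i - Posz s is Posz j then P`_j else 0) = (P * 'X^s)`_i.
  rewrite coefMXn; case: ltnP => [ltis|leis]; last by rewrite subzn.
  by rewrite -opprB subzn 1?ltnW // -(subnSK ltis).
rewrite eval_qpolynomial_binom -coef_comp_polyZX.
rewrite (prod_geom_rotate (ltnW hb) co_bd hw nE uS SE) -/P.
have -> : P * (1 + ('X - 1) * \sum_(s <- S) 'X^s) =
    P + \sum_(s <- S) P * 'X^(s.+1) - \sum_(s <- S) P * 'X^s.
  under [X in _ + X - _]eq_bigr do rewrite exprS mulrA.
  by rewrite -!mulr_sumr; ring.
rewrite coefB coefD !coef_sum (PE k); congr (_ + _ - _).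
  (* The shift by s + 1 is the argument k - 1 - s of the statement. *)
  apply: eq_bigr => s _; rewrite -PsubE -PE.
  by rewrite -addn1 PoszD rmorphB rmorphD /= opprD addrA addrAC.
by apply: eq_bigr => s _; rewrite -PsubE -PE rmorphB.
Qed.
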